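(* The cut rule is eliminable from derivations in $LJ^{(1)=}$ and in $LK^{(1)=}$; that is, every sequent derivable in $LJ^{(1)=}$ (respectively $LK^{(1)=}$) has a derivation in $LJ^{(1)=}$ (respectively $LK^{(1)=}$) that does not use the cut rule.
   Context: The language is first-order with equality and function symbols; free and bound object variables are syntactically distinct, and terms contain only free variables. A sequent $\Gamma\Rightarrow\Delta$ consists of two finite sequences of formulae. $F\{v/t\}$ is the result of simultaneously replacing all occurrences of the free object variable $v$ in $F$ by the term $t$. $LK$ is Gentzen's classical sequent calculus: logical axioms $F\Rightarrow F$ for every formula $F$; the structural rules of left and right weakening, exchange and contraction, and the cut rule (from $\Gamma\Rightarrow\Delta,F$ and $\Lambda,F\Rightarrow\Theta$ infer $\Gamma,\Lambda\Rightarrow\Delta,\Theta$); and the usual left and right logical rules for $\neg,\wedge,\vee,\to,\forall,\exists$, where the left rule for $\forall$ and the right rule for $\exists$ may be instantiated with an arbitrary term. $LJ$ is Gentzen's intuitionistic calculus, in which all sequents have at most one formula in the succedent. $LJ^{(1)=}$ is obtained from $LJ$ by adding the Reflexivity Axiom $\Rightarrow r=r$ (for every term $r$) and the rule $(=\,\Rightarrow)$: from $\Lambda\Rightarrow F\{v/r\}$ and $\Gamma,F\{v/s\}\Rightarrow\Delta$ infer $\Lambda,\Gamma,r=s\Rightarrow\Delta$ (with $|\Delta|\le 1$), where $F$ is any first-order formula, $r,s$ are terms and $v$ is a free object variable. $LK^{(1)=}$ is the classical version, obtained from $LK$ by adding the Reflexivity Axiom and the rule: from $\Lambda\Rightarrow\Theta,F\{v/r\}$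 and $\Gamma,F\{v/s\}\Rightarrow\Delta$ infer $\Lambda,\Gamma,r=s\Rightarrow\Theta,\Delta$. *)

(* Defs.v *)
From Stdlib Require List.
From mathcomp Require Import all_boot.

Set Implicit Arguments.
Unset Strict Implicit.
Unset Printing Implicit Defensive.

(** * Syntax *)

Record signature := Signature {
  fun_symb : Type;
  fun_ar : fun_symb -> nat;
  pred_symb : Type;
  pred_ar : pred_symb -> nat
}.

(* Free object variables are named by natural numbers; [B] is the type of the
   bound object variables that may occur. *)
Inductive tm (Sg : signature) (B : Type) :=
| Free of nat
| Bound of B
| App (f : fun_symb Sg) of {ffun 'I_(fun_ar f) -> tm Sg B}.
Arguments Free {Sg B}.
Arguments Bound {Sg B}.
Arguments App {Sg B}.

(* Terms contain only free variables.  Inside the scope of quantifiers one finds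
   semiterms, whose bound variables are also named by natural numbers. *)
Definition term (Sg : signature) := tm Sg void.
Definition semiterm (Sg : signature) := tm Sg nat.

Fixpoint emb (Sg : signature) (t : term Sg) : semiterm Sg :=
  match t with
  | Free v => Free v
  | Bound b => match b with end
  | App f a => App f [ffun i => emb (a i)]
  end.
Coercion emb : term >-> semiterm.

(* Raw formulae, possibly with dangling bound variables; see [is_formula]. *)
Inductive form (Sg : signature) :=
| Eq of semiterm Sg & semiterm Sg
| Pred (p : pred_symb Sg) of {ffun 'I_(pred_ar p) -> semiterm Sg}
| Neg of form Sg
| And of form Sg & form Sg
| Or of form Sg & form Sg
| Imp of form Sg & form Sg
| All of nat & form Sg
| Ex of nat & form Sg.
Arguments Pred {Sg}.

Fixpoint tm_scoped (Sg : signature) (X : seq nat) (t : semiterm Sg) : bool :=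
  match t with
  | Free _ => true
  | Bound x => x \in X
  | App f a => [forall i, tm_scoped X (a i)]
  end.

(* All bound variables of [A] are bound in [A] or belong to [X], and no
   quantifier of [A] reuses a variable of an enclosing quantifier or of [X]. *)
Fixpoint scoped (Sg : signature) (X : seq nat) (A : form Sg) : bool :=
  match A with
  | Eq t u => tm_scoped X t && tm_scoped X u
  | Pred p a => [forall i, tm_scoped X (a i)]
  | Neg A => scoped X A
  | And A B | Or A B | Imp A B => scoped X A && scoped X B
  | All x A | Ex x A => (x \notin X) && scoped (x :: X) A
  end.

(* The formulae proper, following Gentzen's formation rule for quantifiers:
   from a formula [F] in which [x] does not occur, form [All x F'] and
   [Ex x F'], where [F'] is [F] with some free variable replaced by [x]. *)
Definition is_formula (Sg : signature) (A : form Sg) : bool := scoped [::] A.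

(** * Substitution *)

(* Terms contain no bound variables, so none of the substitutions below can
   capture a variable. *)

Fixpoint tm_fsubst (Sg : signature) (v : nat) (t : term Sg) (u : semiterm Sg) :
    semiterm Sg :=
  match u with
  | Free w => if w == v then emb t else Free w
  | Bound x => Bound x
  | App f a => App f [ffun i => tm_fsubst v t (a i)]
  end.

(* [fsubst v t A] is A{v/t}. *)
Fixpoint fsubst (Sg : signature) (v : nat) (t : term Sg) (A : form Sg) :
    form Sg :=
  match A with
  | Eq u u' => Eq (tm_fsubst v t u) (tm_fsubst v t u')
  | Pred p a => Pred p [ffun i => tm_fsubst v t (a i)]
  | Neg A => Neg (fsubst v t A)
  | And A B => And (fsubst v t A) (fsubst v t B)
  | Or A B => Or (fsubst v t A) (fsubst v t B)
  | Imp A B => Imp (fsubst v t A) (fsubst v t B)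
  | All x A => All x (fsubst v t A)
  | Ex x A => Ex x (fsubst v t A)
  end.

Fixpoint tm_inst (Sg : signature) (x : nat) (t : term Sg) (u : semiterm Sg) :
    semiterm Sg :=
  match u with
  | Free w => Free w
  | Bound y => if y == x then emb t else Bound y
  | App f a => App f [ffun i => tm_inst x t (a i)]
  end.

(* [inst x t A] replaces all occurrences of the bound variable [x] in [A] by
   [t]; it is used when [All x A] or [Ex x A] is a formula, so that no
   quantifier of [A] binds [x]. *)
Fixpoint inst (Sg : signature) (x : nat) (t : term Sg) (A : form Sg) : form Sg :=
  match A with
  | Eq u u' => Eq (tm_inst x t u) (tm_inst x t u')
  | Pred p a => Pred p [ffun i => tm_inst x t (a i)]
  | Neg A => Neg (inst x t A)
  | And A B => And (inst x t A) (inst x t B)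
  | Or A B => Or (inst x t A) (inst x t B)
  | Imp A B => Imp (inst x t A) (inst x t B)
  | All y A => All y (inst x t A)
  | Ex y A => Ex y (inst x t A)
  end.

Fixpoint tm_occurs (Sg : signature) (v : nat) (u : semiterm Sg) : bool :=
  match u with
  | Free w => w == v
  | Bound _ => false
  | App f a => [exists i, tm_occurs v (a i)]
  end.

Fixpoint occurs (Sg : signature) (v : nat) (A : form Sg) : bool :=
  match A with
  | Eq u u' => tm_occurs v u || tm_occurs v u'
  | Pred p a => [exists i, tm_occurs v (a i)]
  | Neg A => occurs v A
  | And A B | Or A B | Imp A B => occurs v A || occurs v B
  | All _ A | Ex _ A => occurs v A
  end.

(** * Sequents and rules *)

Definition sequent (Sg : signature) : Type := (seq (form Sg) * seq (form Sg))%type.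

Declare Scope sequent_scope.
Delimit Scope sequent_scope with sequent.
Notation "G ⟹ D" := (@pair (seq (form _)) (seq (form _)) G D)
  (at level 70, no associativity) : sequent_scope.
Local Open Scope sequent_scope.

Definition seq_occurs (Sg : signature) (v : nat) (S : sequent Sg) : bool :=
  has (occurs v) S.1 || has (occurs v) S.2.

(* A rule scheme relates the list of premises to the conclusion. *)
Definition rule_scheme (Sg : signature) :=
  seq (sequent Sg) -> sequent Sg -> Prop.

(* The rules of Gentzen's LK other than cut.  The LJ rules are the instances in
   which every sequent has at most one succedent formula; see [LJ_sequent]. *)
Inductive gentzen_rule (Sg : signature) : rule_scheme Sg :=
| Ax F :
    gentzen_rule [::] ([:: F] ⟹ [:: F])
| WeakL G D F :
    gentzen_rule [:: G ⟹ D] (G ++ [:: F] ⟹ D)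
| WeakR G D F :
    gentzen_rule [:: G ⟹ D] (G ⟹ D ++ [:: F])
| ExchL G L D E F :
    gentzen_rule [:: G ++ [:: E; F] ++ L ⟹ D] (G ++ [:: F; E] ++ L ⟹ D)
| ExchR G D T E F :
    gentzen_rule [:: G ⟹ D ++ [:: E; F] ++ T] (G ⟹ D ++ [:: F; E] ++ T)
| ContrL G D F :
    gentzen_rule [:: G ++ [:: F; F] ⟹ D] (G ++ [:: F] ⟹ D)
| ContrR G D F :
    gentzen_rule [:: G ⟹ D ++ [:: F; F]] (G ⟹ D ++ [:: F])
| NegL G D A :
    gentzen_rule [:: G ⟹ D ++ [:: A]] (G ++ [:: Neg A] ⟹ D)
| NegR G D A :
    gentzen_rule [:: G ++ [:: A] ⟹ D] (G ⟹ D ++ [:: Neg A])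
| AndL1 G D A B :
    gentzen_rule [:: G ++ [:: A] ⟹ D] (G ++ [:: And A B] ⟹ D)
| AndL2 G D A B :
    gentzen_rule [:: G ++ [:: B] ⟹ D] (G ++ [:: And A B] ⟹ D)
| AndR G D A B :
    gentzen_rule [:: G ⟹ D ++ [:: A]; G ⟹ D ++ [:: B]]
                 (G ⟹ D ++ [:: And A B])
| OrL G D A B :
    gentzen_rule [:: G ++ [:: A] ⟹ D; G ++ [:: B] ⟹ D]
                 (G ++ [:: Or A B] ⟹ D)
| OrR1 G D A B :
    gentzen_rule [:: G ⟹ D ++ [:: A]] (G ⟹ D ++ [:: Or A B])
| OrR2 G D A B :
    gentzen_rule [:: G ⟹ D ++ [:: B]] (G ⟹ D ++ [:: Or A B])
| ImpL G L D T A B :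
    gentzen_rule [:: G ⟹ D ++ [:: A]; L ++ [:: B] ⟹ T]
                 (G ++ L ++ [:: Imp A B] ⟹ D ++ T)
| ImpR G D A B :
    gentzen_rule [:: G ++ [:: A] ⟹ D ++ [:: B]] (G ⟹ D ++ [:: Imp A B])
| AllL G D x A (t : term Sg) :
    gentzen_rule [:: G ++ [:: inst x t A] ⟹ D] (G ++ [:: All x A] ⟹ D)
| AllR G D x A v :
    ~~ seq_occurs v (G ⟹ D ++ [:: All x A]) ->
    gentzen_rule [:: G ⟹ D ++ [:: inst x (Free v) A]]
                 (G ⟹ D ++ [:: All x A])
| ExL G D x A v :
    ~~ seq_occurs v (G ++ [:: Ex x A] ⟹ D) ->
    gentzen_rule [:: G ++ [:: inst x (Free v) A] ⟹ D]
                 (G ++ [:: Ex x A] ⟹ D)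
| ExR G D x A (t : term Sg) :
    gentzen_rule [:: G ⟹ D ++ [:: inst x t A]] (G ⟹ D ++ [:: Ex x A]).

Inductive cut_rule (Sg : signature) : rule_scheme Sg :=
| Cut G D L T F :
    cut_rule [:: G ⟹ D ++ [:: F]; L ++ [:: F] ⟹ T] (G ++ L ⟹ D ++ T).

Inductive eq1_rule (Sg : signature) : rule_scheme Sg :=
| EqRefl (r : term Sg) :
    eq1_rule [::] ([::] ⟹ [:: Eq r r])
| EqL L T G D F v (r s : term Sg) :
    eq1_rule [:: L ⟹ T ++ [:: fsubst v r F]; G ++ [:: fsubst v s F] ⟹ D]
             (L ++ G ++ [:: Eq r s] ⟹ T ++ D).

Definition rule_union (Sg : signature) (R1 R2 : rule_scheme Sg) :
    rule_scheme Sg :=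
  fun ps c => R1 ps c \/ R2 ps c.

(** * Derivability *)

(* There is a derivation of the sequent by the rules [R] all of whose sequents
   satisfy [ok]. *)
Inductive derivable (Sg : signature) (ok : sequent Sg -> bool)
    (R : rule_scheme Sg) : sequent Sg -> Prop :=
| Infer ps c :
    ok c -> R ps c -> (forall p, List.In p ps -> derivable ok R p) ->
    derivable ok R c.

Definition LK_sequent (Sg : signature) (S : sequent Sg) : bool :=
  all (@is_formula Sg) S.1 && all (@is_formula Sg) S.2.

Definition LJ_sequent (Sg : signature) (S : sequent Sg) : bool :=
  LK_sequent S && (size S.2 <= 1).

Definition LK1eq_cutfree_rule (Sg : signature) : rule_scheme Sg :=
  rule_union (@gentzen_rule Sg) (@eq1_rule Sg).

Definition LK1eq_rule (Sg : signature) : rule_scheme Sg :=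
  rule_union (@LK1eq_cutfree_rule Sg) (@cut_rule Sg).

Definition LK1eq (Sg : signature) : sequent Sg -> Prop :=
  derivable (@LK_sequent Sg) (@LK1eq_rule Sg).

Definition LK1eq_cutfree (Sg : signature) : sequent Sg -> Prop :=
  derivable (@LK_sequent Sg) (@LK1eq_cutfree_rule Sg).

Definition LJ1eq (Sg : signature) : sequent Sg -> Prop :=
  derivable (@LJ_sequent Sg) (@LK1eq_rule Sg).

Definition LJ1eq_cutfree (Sg : signature) : sequent Sg -> Prop :=
  derivable (@LJ_sequent Sg) (@LK1eq_cutfree_rule Sg).

(* Main.v *)
Require Import Defs.
From Stdlib Require List Permutation.
From mathcomp Require Import all_boot.

Set Implicit Arguments.
Unset Strict Implicit.
Unset Printing Implicit Defensive.
Local Open Scope sequent_scope.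

(** The proof is semantic and treats both calculi at once.  Every formula is
    interpreted by a set of contexts, soundness is proved for all rules
    including cut, and the interpretation is arranged so that validity of a
    sequent already yields a cut-free derivation of it.

    A context is a sequent, and contexts are combined by concatenation
    ([merge]).  An element ([elt]) is a context that may be merged to the left
    of any sequent of the calculus, so its succedent is empty in LJ; a test is
    an arbitrary sequent of the calculus.  Cut-free derivability of
    [merge p q] is an orthogonality relation between elements [p] and tests
    [q].  The value [val A] of a formula is a set of elements equal to its own
    double orthogonal ([val_closed]), the dual [coval A] is the set of tests
    orthogonal to it, and the connectives and quantifiers are read off their
    rules.  Values being closed, cut is sound: if [p] is in [val A] and [q] in
    [coval A], then [merge p q] is derivable without cut by definition.
    Conversely A ⟹ lies in [val A] and ⟹ A in [coval A] ([val_self]),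
    because each logical rule is available in the cut-free calculus.
    Evaluating a valid sequent at these contexts gives the sequent back.
    Derivations with cuts are met only in the rule-by-rule induction for
    soundness, so no measure on cuts is involved.

    The point peculiar to equality is the value of r = s.  If it were the set
    of contexts from which r = s is derivable, replacement would have to be
    proved from derivability; if it consisted of the contexts that act like
    r = s in every instance of the equality rule, reflexivity would be cut
    elimination for the formula in which one replaces.  Instead, p
    belongs to the value of r = s when, for atoms A and B that differ by
    replacing r by s or s by r, every derivable e ⟹ A gives a derivable
    p, e ⟹ B ([leibniz]).  For r = r this holds by weakening, the formula r = s
    itself satisfies it by the equality rule applied with an axiom as second
    premise ([provable_eq], [provable_eq_sym]), and taking r = r for A and
    r = s for B shows that r = s is derivable from p.  Replacement in arbitrary
    formulae, hence soundness of the full equality rule, follows by induction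
    on the formula ([val_rep]). *)

Section CutElimination.
Variable Sg : signature.
Implicit Types (A B : form Sg) (u w : semiterm Sg) (t r s : term Sg).
Implicit Types (p q e : sequent Sg) (th : semiterm Sg -> semiterm Sg).

(** * Terms and formulae *)

Lemma tm_ind_ffun T (P : tm Sg T -> Prop) :
  (forall v, P (Free v)) -> (forall b, P (Bound b)) ->
  (forall f (a : {ffun 'I_(fun_ar f) -> tm Sg T}),
     (forall i, P (a i)) -> P (App f a)) ->
  forall u : tm Sg T, P u.
Proof.
move=> HF HB HA; fix IH 1; case=> [v|b|f a]; [exact: HF|exact: HB|].
by apply: HA => i; apply: IH.
Qed.

(** Both kinds of substitution, and their composites, are maps on semiterms
    pushed under the quantifiers.  Handling them all through one operation
    reduces the substitution lemmas for formulae to those for terms. *)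
Fixpoint form_map th A : form Sg :=
  match A with
  | Eq u u' => Eq (th u) (th u')
  | Pred p a => Pred p [ffun i => th (a i)]
  | Neg A => Neg (form_map th A)
  | And A B => And (form_map th A) (form_map th B)
  | Or A B => Or (form_map th A) (form_map th B)
  | Imp A B => Imp (form_map th A) (form_map th B)
  | All x A => All x (form_map th A)
  | Ex x A => Ex x (form_map th A)
  end.

Lemma inst_map x t A : inst x t A = form_map (tm_inst x t) A.
Proof. by elim: A => //= [?->|?->?->|?->?->|?->?->|??->|??->]. Qed.

Lemma fsubst_map v t A : fsubst v t A = form_map (tm_fsubst v t) A.
Proof. by elim: A => //= [?->|?->?->|?->?->|?->?->|??->|??->]. Qed.

Lemma form_map_comp th th' A :
  form_map th' (form_map th A) = form_map (th' \o th) A.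
Proof.
elim: A => //= [p a|?->|?->?->|?->?->|?->?->|??->|??->] //.
by congr Pred; apply/ffunP=> i; rewrite !ffunE.
Qed.

Lemma form_map_id th A : th =1 id -> form_map th A = A.
Proof.
move=> H; elim: A => //= [u u'|p a|?->|?->?->|?->?->|?->?->|??->|??->] //.
  by rewrite !H.
by congr Pred; apply/ffunP=> i; rewrite !ffunE H.
Qed.

Lemma tm_scoped_emb X t : tm_scoped X (emb t).
Proof.
elim/tm_ind_ffun: t => [v|[]|f a IH] //=.
by apply/forallP=> i; rewrite ffunE.
Qed.

Lemma scoped_term u : tm_scoped [::] u -> exists t, u = emb t.
Proof.
elim/tm_ind_ffun: u => [v|b|f a IH] //= H; first by exists (Free v).
have /fin_all_exists [b Hb] : forall i, exists t, a i = emb t.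
  by move=> i; apply: IH; apply: (forallP H).
exists (App f [ffun i => b i]) => /=; congr App.
by apply/ffunP=> i; rewrite !ffunE Hb.
Qed.

Lemma tm_inst_emb x t r : tm_inst x t (emb r) = emb r.
Proof.
elim/tm_ind_ffun: r => [v|[]|f a IH] //=; congr App.
by apply/ffunP=> i; rewrite !ffunE IH.
Qed.

Lemma tm_fsubst_fresh v t u : ~~ tm_occurs v u -> tm_fsubst v t u = u.
Proof.
elim/tm_ind_ffun: u => [w|b|f a IH] //=; first by case: eqP.
rewrite negb_exists => /forallP H; congr App.
by apply/ffunP=> i; rewrite !ffunE IH.
Qed.

Lemma tm_scoped_inst X X' x t u : (forall z, z \in X -> z != x -> z \in X') ->
  tm_scoped X u -> tm_scoped X' (tm_inst x t u).
Proof.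
move=> H; elim/tm_ind_ffun: u => [w|b|f a IH] //=.
  by move=> Hb; case: eqP => [_|/eqP Hx]; [exact: tm_scoped_emb|exact: H].
by move/forallP=> Ha; apply/forallP=> i; rewrite ffunE IH.
Qed.

(** The two inclusions say that [X'] is [X] up to [x]; the first one ensures that
    the quantifiers of [A], whose variables avoid [X], also avoid [X']. *)
Lemma scoped_inst X X' x t A : {subset X' <= X} ->
    (forall z, z \in X -> z != x -> z \in X') ->
  scoped X A -> scoped X' (inst x t A).
Proof.
have Q y (Y Y' : seq nat) B : (forall Y Y' : seq nat, {subset Y' <= Y} ->
      (forall z, z \in Y -> z != x -> z \in Y') ->
      scoped Y B -> scoped Y' (inst x t B)) ->
    {subset Y' <= Y} -> (forall z, z \in Y -> z != x -> z \in Y') ->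
    (y \notin Y) && scoped (y :: Y) B ->
    (y \notin Y') && scoped (y :: Y') (inst x t B).
  move=> IH sub H /andP[Hy HB]; apply/andP; split.
    by apply: contra Hy => /sub.
  apply: (IH _ _ _ _ HB) => z; rewrite !inE => /orP[->|] // Hz.
    by rewrite sub ?orbT.
  by move=> Hx; rewrite H ?orbT.
elim: A X X' => /=
  [u u'|p a|A IH|A IHA B IHB|A IHA B IHB|A IHA B IHB|y A IH|y A IH] X X' sub H.
- by case/andP=> Hu Hu'; rewrite !(@tm_scoped_inst X).
- move/forallP=> Ha; apply/forallP=> i; rewrite ffunE.
  exact: (@tm_scoped_inst X).
- exact: IH.
- by case/andP=> HA HB; rewrite (IHA X) ?(IHB X).
- by case/andP=> HA HB; rewrite (IHA X) ?(IHB X).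
- by case/andP=> HA HB; rewrite (IHA X) ?(IHB X).
- exact: Q.
- exact: Q.
Qed.

Lemma is_formula_inst x t A :
  (x \notin [::]) && scoped [:: x] A -> is_formula (inst x t A).
Proof. by apply: scoped_inst => // z; rewrite inE => ->. Qed.

Lemma scoped_map th X A :
  (forall X u, tm_scoped X u -> tm_scoped X (th u)) ->
  scoped X A -> scoped X (form_map th A).
Proof.
move=> H; elim: A X => /=
  [u u'|p a|A IH|A IHA B IHB|A IHA B IHB|A IHA B IHB|y A IH|y A IH] X;
  try by case/andP=> HA HB; apply/andP; split; auto.
- by move/forallP=> Ha; apply/forallP=> i; rewrite ffunE H.
- exact: IH.
Qed.

Lemma tm_fresh u : exists n, forall v, n <= v -> ~~ tm_occurs v u.
Proof.
elim/tm_ind_ffun: u => [w|b|f a IH] /=.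
- by exists w.+1 => v; apply: contraTneq => ->; rewrite ltnn.
- by exists 0.
- have [n Hn] := fin_all_exists IH.
  exists (\max_i n i) => v Hv; rewrite negb_exists; apply/forallP=> i.
  by apply: Hn; apply: leq_trans Hv; apply: leq_bigmax.
Qed.

Lemma form_fresh A : exists n, forall v, n <= v -> ~~ occurs v A.
Proof.
have Q P1 P2 : (exists n, forall v : nat, n <= v -> ~~ P1 v) ->
    (exists n, forall v, n <= v -> ~~ P2 v) ->
    exists n, forall v, n <= v -> ~~ (P1 v || P2 v).
  case=> n1 H1 [n2 H2]; exists (maxn n1 n2) => v.
  by rewrite geq_max negb_or => /andP[/H1 -> /H2 ->].
elim: A => //= [u u'|p a|*|*|*]; try exact: Q; first by apply: Q; exact: tm_fresh.
have [n Hn] := fin_all_exists (fun i => tm_fresh (a i)).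
exists (\max_i n i) => v Hv; rewrite negb_exists; apply/forallP=> i.
by apply: Hn; apply: leq_trans Hv; apply: leq_bigmax.
Qed.

Lemma forms_fresh (G : seq (form Sg)) :
  exists n, forall v, n <= v -> ~~ has (occurs v) G.
Proof.
elim: G => [|A G [n Hn]] /=; first by exists 0.
have [m Hm] := form_fresh A; exists (maxn n m) => v.
by rewrite geq_max negb_or => /andP[/Hn -> /Hm ->].
Qed.

Lemma sequent_fresh p : exists v, ~~ seq_occurs v p.
Proof.
have [n Hn] := forms_fresh p.1; have [m Hm] := forms_fresh p.2.
by exists (maxn n m); rewrite negb_or Hn ?Hm ?leq_maxl ?leq_maxr.
Qed.

(** A simultaneous substitution, needed because soundness must be proved for
    all values of the eigenvariables together. *)
Fixpoint tm_subst (sg : nat -> term Sg) u : semiterm Sg :=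
  match u with
  | Free w => emb (sg w)
  | Bound x => Bound x
  | App f a => App f [ffun i => tm_subst sg (a i)]
  end.

Definition update (sg : nat -> term Sg) v t : nat -> term Sg :=
  fun y => if y == v then t else sg y.

Lemma tm_subst_free : tm_subst Free =1 id.
Proof.
elim/tm_ind_ffun=> [v|b|f a IH] //=; congr App.
by apply/ffunP=> i; rewrite ffunE IH.
Qed.

Lemma tm_subst_emb sg t : exists t', tm_subst sg (emb t) = emb t'.
Proof.
apply: scoped_term; elim/tm_ind_ffun: t => [v|[]|f a IH] /=.
  exact: tm_scoped_emb.
by apply/forallP=> i; rewrite !ffunE.
Qed.

Lemma tm_scoped_subst sg X u : tm_scoped X u -> tm_scoped X (tm_subst sg u).
Proof.
elim/tm_ind_ffun: u => [w|b|f a IH] //=; first by rewrite tm_scoped_emb.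
by move/forallP=> Ha; apply/forallP=> i; rewrite ffunE IH.
Qed.

Lemma tm_subst_inst sg x t t' u : tm_subst sg (emb t) = emb t' ->
  tm_subst sg (tm_inst x t u) = tm_inst x t' (tm_subst sg u).
Proof.
move=> Ht; elim/tm_ind_ffun: u => [w|b|f a IH] /=.
- by rewrite tm_inst_emb.
- by case: eqP.
- by congr App; apply/ffunP=> i; rewrite !ffunE.
Qed.

Lemma tm_subst_update sg v t u :
  ~~ tm_occurs v u -> tm_subst (update sg v t) u = tm_subst sg u.
Proof.
elim/tm_ind_ffun: u => [w|b|f a IH] //=; first by rewrite /update; case: eqP.
rewrite negb_exists => /forallP H; congr App.
by apply/ffunP=> i; rewrite !ffunE IH.
Qed.

(** * Replacing equals by equals *)

(** Replacement of some of the occurrences of [w] by [w'], as a relation: unlike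
    a presentation by a term with a marked variable, it is stable under
    instantiation by arbitrary terms without any renaming. *)
Inductive rep w w' : semiterm Sg -> semiterm Sg -> Prop :=
| RepRefl u : rep w w' u u
| RepHere : rep w w' w w'
| RepApp f (a b : {ffun 'I_(fun_ar f) -> semiterm Sg}) :
    (forall i, rep w w' (a i) (b i)) -> rep w w' (App f a) (App f b).

Inductive atom_rep w w' : form Sg -> form Sg -> Prop :=
| RepEq u u' z z' : rep w w' u z -> rep w w' u' z' ->
    atom_rep w w' (Eq u u') (Eq z z')
| RepPred (p : pred_symb Sg) (a b : {ffun 'I_(pred_ar p) -> semiterm Sg}) :
    (forall i, rep w w' (a i) (b i)) ->
    atom_rep w w' (Pred p a) (Pred p b).

Lemma rep_sym w w' u z : rep w w' u z -> rep w' w z u.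
Proof. by elim=> *; constructor. Qed.

Lemma rep_refl w u z : rep w w u z -> u = z.
Proof.
elim=> // f a b _ IH; congr App; apply/ffunP=> i; exact: IH.
Qed.

Lemma atom_rep_refl w A B : atom_rep w w A B -> A = B.
Proof.
case=> [u u' z z' /rep_refl-> /rep_refl-> //|P a b H].
by congr Pred; apply/ffunP=> i; apply: rep_refl.
Qed.

Lemma rep_inst x t r s u z :
  rep r s u z -> rep r s (tm_inst x t u) (tm_inst x t z).
Proof.
elim=> [y||f a b _ IH] /=; [exact: RepRefl| |].
  by rewrite !tm_inst_emb; exact: RepHere.
by apply: RepApp => i; rewrite !ffunE.
Qed.

Lemma rep_fsubst sg v r s r' s' u :
  tm_subst sg (emb r) = emb r' -> tm_subst sg (emb s) = emb s' ->
  rep r' s' (tm_subst sg (tm_fsubst v r u)) (tm_subst sg (tm_fsubst v s u)).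
Proof.
move=> Hr Hs; elim/tm_ind_ffun: u => [w|b|f a IH] /=.
- by case: eqP => _ /=; [rewrite Hr Hs; exact: RepHere|exact: RepRefl].
- exact: RepRefl.
- by apply: RepApp => i; rewrite !ffunE.
Qed.

Lemma rep_scoped X w w' u z :
  tm_scoped X w' -> rep w w' u z -> tm_scoped X u -> tm_scoped X z.
Proof.
move=> Hw; elim=> // f a b _ IH /= /forallP H.
by apply/forallP=> i; apply: IH.
Qed.

Lemma atom_rep_formula w w' A B : tm_scoped [::] w' -> atom_rep w w' A B ->
  is_formula A -> is_formula B.
Proof.
move=> Hw [u u' z z' Hu Hu'|p a b Hab]; rewrite /is_formula /=.
  by case/andP=> Su Su'; rewrite (rep_scoped Hw Hu) ?(rep_scoped Hw Hu').
move/forallP=> H; apply/forallP=> i; exact: (rep_scoped Hw (Hab i)).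
Qed.

(** Marking the replaced occurrences by a variable [v] turns a replacement
    into a pair of substitution instances.  Freshness for [u] alone suffices,
    since only unreplaced parts of [u] must be free of [v]. *)
Lemma rep_context r s u z v : ~~ tm_occurs v u -> rep r s u z ->
  exists k, u = tm_fsubst v r k /\ z = tm_fsubst v s k.
Proof.
move=> Hv H; elim: H Hv => [y||f a b _ IH] /=.
- by move=> Hy; exists y; rewrite !tm_fsubst_fresh.
- by exists (Free v) => /=; rewrite eqxx.
- rewrite negb_exists => /forallP Hv.
  have /fin_all_exists [k Hk] : forall i, exists k,
      a i = tm_fsubst v r k /\ b i = tm_fsubst v s k by move=> i; apply: IH.
  exists (App f [ffun i => k i]) => /=.
  by split; congr App; apply/ffunP=> i; rewrite !ffunE; case: (Hk i).
Qed.

(** The form in which the equality rule can be applied to a replacement. *)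
Lemma atom_rep_context r s A B : atom_rep r s A B ->
  exists F v, A = fsubst v r F /\ B = fsubst v s F.
Proof.
move=> H; have [v Hv] := form_fresh A; have {}Hv := Hv v (leqnn v).
case: H Hv => [u u' z z' Hu Hu'|p a b Hab] /=.
  rewrite negb_or => /andP[/rep_context/(_ Hu) [k [-> ->]]].
  by case/rep_context/(_ Hu') => k' [-> ->]; exists (Eq k k'), v.
rewrite negb_exists => /forallP Hv.
have /fin_all_exists [k Hk] : forall i, exists k,
    a i = tm_fsubst v r k /\ b i = tm_fsubst v s k.
  by move=> i; apply: rep_context.
exists (Pred p [ffun i => k i]), v => /=.
by split; congr Pred; apply/ffunP=> i; rewrite !ffunE; case: (Hk i).
Qed.

(** Used for replacement inside an equation u1 = z2: replacing u1 by z2 is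
    replacing u1 by u2, then u2 by z1, then z1 by z2. *)
Lemma rep_factor w1 w2 u1 u2 z1 z2 x y :
    rep w1 w2 u1 u2 -> rep w2 w1 z1 z2 -> rep u1 z2 x y ->
  exists x' y', [/\ rep w1 w2 x x', rep u2 z1 x' y' & rep w2 w1 y' y].
Proof.
move=> Hu Hz; elim=> [a||f a b _ IH].
- by exists a, a; split; exact: RepRefl.
- by exists u2, z1; split=> //; exact: RepHere.
- have [a' /fin_all_exists [b' H]] := fin_all_exists IH.
  exists (App f [ffun i => a' i]), (App f [ffun i => b' i]).
  by split; apply: RepApp => i; rewrite !ffunE; case: (H i).
Qed.

Lemma atom_rep_factor w1 w2 u1 u2 z1 z2 A B :
    rep w1 w2 u1 u2 -> rep w2 w1 z1 z2 -> atom_rep u1 z2 A B ->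
  exists A' B', [/\ atom_rep w1 w2 A A', atom_rep u2 z1 A' B' &
                    atom_rep w2 w1 B' B].
Proof.
move=> Hu Hz [x x' y y' /(rep_factor Hu Hz)[a [b [H1 H2 H3]]]
  /(rep_factor Hu Hz)[a' [b' [H1' H2' H3']]]|p a b Hab].
  by exists (Eq a a'), (Eq b b'); split; constructor.
have [a' /fin_all_exists [b' H]] :=
  fin_all_exists (fun i => rep_factor Hu Hz (Hab i)).
exists (Pred p [ffun i => a' i]), (Pred p [ffun i => b' i]).
by split; apply: RepPred => i; rewrite ?ffunE; case: (H i).
Qed.

(** * Contexts *)

Variable classical : bool.

(** The sequents of the calculus, which also serve as the tests. *)
Definition ok : sequent Sg -> bool :=
  if classical then @LK_sequent Sg else @LJ_sequent Sg.

(** In LJ an element has an empty succedent, so that merging it with a test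
    leaves at most one succedent formula.  In LK elements and tests coincide. *)
Definition elt p : bool := LK_sequent p && (classical || nilp p.2).

Definition merge p q : sequent Sg := (p.1 ++ q.1) ⟹ (p.2 ++ q.2).

Notation lhs A := (@pair (seq (form Sg)) (seq (form Sg)) [:: A] [::]).
Notation rhs A := (@pair (seq (form Sg)) (seq (form Sg)) [::] [:: A]).

Lemma okE p : ok p = LK_sequent p && (classical || (size p.2 <= 1)).
Proof. by rewrite /ok; case: classical; rewrite ?andbT. Qed.

Lemma LK_merge p q : LK_sequent (merge p q) = LK_sequent p && LK_sequent q.
Proof.
by rewrite /LK_sequent /merge /= !all_cat; do 4!case: all.
Qed.

Lemma elt_ok p : elt p -> ok p.
Proof.
by rewrite okE /elt /nilp => /andP[->]; case: classical => //= /eqP->.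
Qed.

Lemma elt_merge p q : elt p -> elt q -> elt (merge p q).
Proof.
rewrite /elt LK_merge => /andP[-> /=] Hp /andP[-> /=]; move: Hp.
by case: classical => //=; case: p.2.
Qed.

Lemma ok_merge p q : elt p -> ok q -> ok (merge p q).
Proof.
rewrite /elt !okE LK_merge => /andP[-> /=] Hp /andP[-> /=]; move: Hp.
by case: classical => //=; case: p.2.
Qed.

Lemma elt_lhs A : elt (lhs A) = is_formula A.
Proof. by rewrite /elt /LK_sequent /= !andbT orbT andbT. Qed.

Lemma ok_rhs A : ok (rhs A) = is_formula A.
Proof. by rewrite okE /LK_sequent /= !andbT orbT andbT. Qed.

Lemma elt0 : elt ([::] ⟹ [::]).
Proof. by rewrite /elt /= orbT. Qed.

(** [List.in_app_iff] is stated for another concatenation, which rewriting does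
    not identify with this one. *)
Lemma In_cat T (x : T) l l' : List.In x (l ++ l') <-> List.In x l \/ List.In x l'.
Proof. exact: List.in_app_iff. Qed.

(** * Structural rules *)

Definition provable : sequent Sg -> Prop := derivable ok (@LK1eq_cutfree_rule Sg).

Definition sub_sequent p q := List.incl p.1 q.1 /\ List.incl p.2 q.2.

Lemma provable_ok p : provable p -> ok p.
Proof. by case. Qed.

Lemma provable0 c : ok c -> gentzen_rule [::] c -> provable c.
Proof. by move=> Hc H; apply: Infer Hc (or_introl H) _. Qed.

Lemma provable1 p c : ok c -> gentzen_rule [:: p] c -> provable p -> provable c.
Proof. by move=> Hc H Hp; apply: Infer Hc (or_introl H) _ => _ [<-|[]]. Qed.

Lemma provable2 p q c : ok c -> gentzen_rule [:: p; q] c ->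
  provable p -> provable q -> provable c.
Proof.
by move=> Hc H Hp Hq; apply: Infer Hc (or_introl H) _ => _ [<-|[<-|[]]].
Qed.

Lemma all_In T (a : pred T) l x : all a l -> List.In x l -> a x.
Proof. by elim: l => //= y l IH /andP[Hy /IH H] [<-|/H]. Qed.

Lemma all_incl T (a : pred T) l l' : List.incl l l' -> all a l' -> all a l.
Proof.
elim: l => //= x l IH H Hl'; rewrite IH //; last by move=> y Hy; apply: H; right.
by rewrite (all_In Hl') //; apply: H; left.
Qed.

(** Induction on the permutation needs a prefix [L], because the exchange rule
    acts inside a sequent. *)
Lemma provable_permL G G' D : Permutation.Permutation G G' ->
  provable (G ⟹ D) -> provable (G' ⟹ D).
Proof.
move=> HG.
suff H : forall L, provable ((L ++ G) ⟹ D) -> provable ((L ++ G') ⟹ D).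
  exact: (H [::]).
elim: HG => [|x l l' _ IH|x y l|l l' l'' _ IH1 _ IH2] L //.
- by rewrite -!cat_rcons; apply: IH.
- move=> H; apply: (provable1 _ (ExchL L l D y x) H).
  move: (provable_ok H); rewrite !okE /LK_sequent /= !all_cat /=.
  by rewrite [is_formula y && (_ && _)]andbCA.
- by move/IH1/IH2.
Qed.

Lemma provable_permR G D D' : Permutation.Permutation D D' ->
  provable (G ⟹ D) -> provable (G ⟹ D').
Proof.
move=> HD.
suff H : forall L, provable (G ⟹ (L ++ D)) -> provable (G ⟹ (L ++ D')).
  exact: (H [::]).
elim: HD => [|x l l' _ IH|x y l|l l' l'' _ IH1 _ IH2] L //.
- by rewrite -!cat_rcons; apply: IH.
- move=> H; apply: (provable1 _ (ExchR G L l y x) H).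
  move: (provable_ok H); rewrite !okE /LK_sequent /= !all_cat /= !size_cat /=.
  by rewrite [is_formula y && (_ && _)]andbCA.
- by move/IH1/IH2.
Qed.

Lemma provable_weakL G D L : all (@is_formula Sg) L ->
  provable (G ⟹ D) -> provable ((G ++ L) ⟹ D).
Proof.
elim: L G => [|A L IH] G /=; first by rewrite cats0.
case/andP=> HA HL H; rewrite -cat_rcons -cats1; apply: IH => //.
apply: (provable1 _ (WeakL G D A) H); move: (provable_ok H).
by rewrite !okE /LK_sequent /= all_cat /= HA => /andP[/andP[-> ->] ->].
Qed.

Lemma provable_contrL G D A :
  provable ((A :: A :: G) ⟹ D) -> provable ((A :: G) ⟹ D).
Proof.
have P l : Permutation.Permutation (l ++ G) (G ++ l).
  exact: Permutation.Permutation_app_comm.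
move/(provable_permL (P [:: A; A])) => H.
apply: (provable_permL (Permutation.Permutation_sym (P [:: A])) _).
apply: (provable1 _ (ContrL G D A) H); move: (provable_ok H).
by rewrite !okE /LK_sequent /= !all_cat /=; case: (is_formula A).
Qed.

(** Contraction of each formula of [L] with one of its copies in [G]. *)
Lemma provable_absorbL L G D : List.incl L G ->
  provable ((L ++ G) ⟹ D) -> provable (G ⟹ D).
Proof.
elim: L => //= A L IH H HP; apply: IH; first by move=> x Hx; apply: H; right.
have [G1 [G2 EG]] := List.in_split _ _ (H A (or_introl erefl)).
have P : Permutation.Permutation (L ++ G) (A :: (L ++ G1 ++ G2)).
  rewrite EG; apply: (Permutation.perm_trans
    (Permutation.Permutation_app_head L
      (Permutation.Permutation_sym (Permutation.Permutation_middle G1 G2 A)))).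
  exact: Permutation.Permutation_sym (Permutation.Permutation_middle L _ A).
apply: (provable_permL (Permutation.Permutation_sym P) _); apply: provable_contrL.
exact: provable_permL (Permutation.perm_skip A P) HP.
Qed.

Lemma provable_inclL G G' D : List.incl G G' -> all (@is_formula Sg) G' ->
  provable (G ⟹ D) -> provable (G' ⟹ D).
Proof.
by move=> H HG' HP; apply: (provable_absorbL H); apply: provable_weakL.
Qed.

Lemma provable_weakR G D D' : ok (G ⟹ (D ++ D')) -> provable (G ⟹ D) ->
  provable (G ⟹ (D ++ D')).
Proof.
elim/last_ind: D' => [|L A IH]; first by rewrite cats0.
rewrite -cats1 catA => Hok H; apply: (provable1 Hok (WeakR G _ A)).
apply: IH => //; move: Hok.
rewrite !okE /LK_sequent /= all_cat size_cat => /andP[/and3P[-> -> _]].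
by case: classical => //= /(leq_trans (leq_addr _ _)).
Qed.

Lemma provable_contrR G D A :
  provable (G ⟹ (A :: A :: D)) -> provable (G ⟹ (A :: D)).
Proof.
have P l : Permutation.Permutation (l ++ D) (D ++ l).
  exact: Permutation.Permutation_app_comm.
move/(provable_permR (P [:: A; A])) => H.
apply: (provable_permR (Permutation.Permutation_sym (P [:: A])) _).
apply: (provable1 _ (ContrR G D A) H); move: (provable_ok H).
rewrite !okE /LK_sequent /= !all_cat /= !size_cat /= !addnS !addn0 ltnS.
case: (is_formula A); rewrite ?andbF // !andbT => /andP[->] /=.
by case: classical => //= /leqW.
Qed.

Lemma provable_absorbR L G D : List.incl L D ->
  provable (G ⟹ (L ++ D)) -> provable (G ⟹ D).
Proof.
elim: L => //= A L IH H HP; apply: IH; first by move=> x Hx; apply: H; right.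
have [D1 [D2 ED]] := List.in_split _ _ (H A (or_introl erefl)).
have P : Permutation.Permutation (L ++ D) (A :: (L ++ D1 ++ D2)).
  rewrite ED; apply: (Permutation.perm_trans
    (Permutation.Permutation_app_head L
      (Permutation.Permutation_sym (Permutation.Permutation_middle D1 D2 A)))).
  exact: Permutation.Permutation_sym (Permutation.Permutation_middle L _ A).
apply: (provable_permR (Permutation.Permutation_sym P) _); apply: provable_contrR.
exact: provable_permR (Permutation.perm_skip A P) HP.
Qed.

Lemma provable_inclR G D D' : List.incl D D' -> ok (G ⟹ D') ->
  provable (G ⟹ D) -> provable (G ⟹ D').
Proof.
move=> H; rewrite okE /LK_sequent /= => /andP[/andP[HG HD']].
case Hc : classical => /= Hsize HP.
  apply: (provable_absorbR H); apply: provable_weakR => //.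
  by rewrite okE /LK_sequent Hc /= HG all_cat HD' (all_incl H HD').
case: D H HP => [|A D] H HP.
  apply: (provable_weakR (D := [::])) => //=.
  by rewrite okE /LK_sequent /= HG HD' Hsize orbT.
have HA := H A (or_introl erefl).
move: (provable_ok HP); rewrite okE Hc /= ltnS leqn0 => /andP[_ /nilP D0].
by case: D' HA {H HD'} Hsize => [|B [|]] //= [->|] //; rewrite -D0.
Qed.

(** All structural rules in one: [q] may permute, contract and extend
    [p] at will.  In LJ the succedent can only grow from empty to a single formula, so
    no proper contraction on the right occurs there. *)
Lemma provable_mono p q : sub_sequent p q -> ok q -> provable p -> provable q.
Proof.
case: p q => [G D] [G' D'] [/= HG HD] Hok H.
apply: (provable_inclR HD Hok); apply: (provable_inclL HG) H.
by move: Hok; rewrite okE => /andP[/andP[]].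
Qed.

(** * The semantics *)

(** The tests that an element of the value of w = w' must pass: it has to turn
    every derivable atom [A] into the derivability of each [B] obtained by
    replacing [w] by [w'].  Atoms are enough, as replacement in compound
    formulae then follows in [val_rep]. *)
Definition leibniz w w' q : Prop := exists A B e,
  [/\ elt e, atom_rep w w' A B, provable (merge e (rhs A)) & q = merge e (rhs B)].

(** Restricting [X] to tests here spares doing so for each of the sets to which
    [orth] is applied. *)
Definition orth (X : sequent Sg -> Prop) p : Prop :=
  elt p /\ forall q, X q -> ok q -> provable (merge p q).

Definition coorth (Y : sequent Sg -> Prop) q : Prop :=
  ok q /\ forall p, Y p -> provable (merge p q).

(** The value of [form_map th A].  The map [th] accumulates the instances
    chosen for the quantifiers met on the way down, which makes the recursion
    structural although instances of [A] are not subformulae of it. *)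
Fixpoint val A th : sequent Sg -> Prop :=
  match A with
  | Eq u u' =>
      orth (fun q => leibniz (th u) (th u') q \/ leibniz (th u') (th u) q)
  | Pred P a => orth (fun q => q = rhs (Pred P [ffun i => th (a i)]))
  | Neg A => orth (val A th)
  | And A B => fun p => val A th p /\ val B th p
  | Or A B => orth (fun q => coorth (val A th) q /\ coorth (val B th) q)
  | Imp A B => orth (fun q => exists a k,
      [/\ val A th a, coorth (val B th) k & q = merge a k])
  | All x A => fun p => forall t, val A (tm_inst x t \o th) p
  | Ex x A => orth (fun q => forall t, coorth (val A (tm_inst x t \o th)) q)
  end.

Notation coval A th := (coorth (val A th)).

Lemma val_elt A th p : val A th p -> elt p.
Proof.
elim: A th p => [u u'|P a|A _|A IHA B _|A _ B _|A _ B _|x A IH|x A _] th p /=;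
  try by case.
- by case=> /IHA.
- by move/(_ (Free 0))/IH.
Qed.

Lemma coval_ok A th q : coval A th q -> ok q.
Proof. by case. Qed.

Lemma val_coval A th p q : val A th p -> coval A th q -> provable (merge p q).
Proof. by move=> Hp [_]; apply. Qed.

(** A triple orthogonal is a single one. *)
Lemma orth_closed (X : sequent Sg -> Prop) p : elt p ->
  (forall q, coorth (orth X) q -> provable (merge p q)) -> orth X p.
Proof.
move=> Hp H; split=> // q Xq Hq; apply: H; split=> // p' [_]; exact.
Qed.

Lemma coorth_anti (Y Z : sequent Sg -> Prop) q :
  (forall p, Y p -> Z p) -> coorth Z q -> coorth Y q.
Proof. by move=> H [Hq Hz]; split=> // p /H/Hz. Qed.

Lemma val_closed A th p : elt p ->
  (forall q, coval A th q -> provable (merge p q)) -> val A th p.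
Proof.
elim: A th => [u u'|P a|A _|A IHA B IHB|A _ B _|A _ B _|x A IH|x A _] th Hp /= H;
  try exact: orth_closed.
- by split; [apply: IHA|apply: IHB] => // q Hq; apply: H;
     apply: coorth_anti Hq => ? [].
- by move=> t; apply: IH => // q Hq; apply: H; apply: coorth_anti Hq => ?; apply.
Qed.

Ltac sub_tac := split; move=> ?; rewrite /= ?In_cat /=; rewrite ?In_cat /=; tauto.

Lemma val_sub A th p p' :
  elt p' -> sub_sequent p p' -> val A th p -> val A th p'.
Proof.
move=> Hp' [H1 H2] Hp; apply: val_closed => // q Hq.
apply: (provable_mono _ _ (val_coval Hp Hq)).
  by split=> x; rewrite /= !In_cat; [case=> [/H1|]|case=> [/H2|]]; tauto.
exact: ok_merge (coval_ok Hq).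
Qed.

Lemma val_mergel A th p q : elt q -> val A th p -> val A th (merge p q).
Proof.
move=> Hq Hp; apply: (val_sub _ _ Hp); last by sub_tac.
exact: elt_merge (val_elt Hp) Hq.
Qed.

Lemma val_merger A th p q : elt q -> val A th p -> val A th (merge q p).
Proof.
move=> Hq Hp; apply: (val_sub _ _ Hp); last by sub_tac.
exact: elt_merge Hq (val_elt Hp).
Qed.

Lemma coval_sub A th q q' :
  ok q' -> sub_sequent q q' -> coval A th q -> coval A th q'.
Proof.
move=> Hq' [H1 H2] [Hq H]; split=> // p Hp.
apply: (provable_mono _ _ (H p Hp)); last exact: ok_merge (val_elt Hp) Hq'.
by split=> x; rewrite /= !In_cat; [case=> [|/H1]|case=> [|/H2]]; tauto.
Qed.

Lemma coorth_iff (Y Z : sequent Sg -> Prop) :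
  (forall p, Y p <-> Z p) -> forall q, coorth Y q <-> coorth Z q.
Proof. by move=> H q; split; apply: coorth_anti => p /H. Qed.

Lemma orth_iff (X Y : sequent Sg -> Prop) :
  (forall q, X q <-> Y q) -> forall p, orth X p <-> orth Y p.
Proof. by move=> H p; split=> -[Hp HX]; split=> // q /H; apply: HX. Qed.

(** The reading of [val A th] as the value of [form_map th A]. *)
Lemma val_map A th th' p :
  val (form_map th A) th' p <-> val A (th' \o th) p.
Proof.
elim: A th' p => [u u'|P a|A IH|A IHA B IHB|A IHA B IHB|A IHA B IHB|x A IH|x A IH]
  th' p /=.
- by [].
- apply: orth_iff => q; suff -> : [ffun i => th' ([ffun i => th (a i)] i)] =
    [ffun i => (th' \o th) (a i)] by [].
  by apply/ffunP=> i; rewrite !ffunE.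
- exact: orth_iff.
- by rewrite IHA IHB.
- by apply: orth_iff => q; rewrite (coorth_iff (IHA th')) (coorth_iff (IHB th')).
- apply: orth_iff => q; split=> -[a [k [/IHA Ha /(coorth_iff (IHB th')) Hk ->]]];
    by exists a, k.
- by split=> H t; have := H t; move/(IH (tm_inst x t \o th')).
- by apply: orth_iff => q; split=> H t; have := H t;
    move/(coorth_iff (IH (tm_inst x t \o th'))).
Qed.

(** All substitution lemmas for values are instances: it is enough to compare
    formulae. *)
Lemma val_eq A th A' th' p :
  form_map th A = form_map th' A' -> val A th p -> val A' th' p.
Proof.
have E B th1 : val (form_map th1 B) id p <-> val B th1 p by exact: val_map.
by move=> H /E; rewrite H => /E.
Qed.

(** * Every formula lies in its own value *)

Lemma ok_split G D :
  ok (G ⟹ D) = [&& all (@is_formula Sg) G, all (@is_formula Sg) D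
   & classical || (size D <= 1)].
Proof. by rewrite okE /LK_sequent /= andbA. Qed.

Lemma elt_split p : elt p -> [/\ all (@is_formula Sg) p.1,
  all (@is_formula Sg) p.2 & classical || (size p.2 == 0)].
Proof. by case/andP=> /andP[]. Qed.

Lemma ok_splitp p : ok p -> [/\ all (@is_formula Sg) p.1,
  all (@is_formula Sg) p.2 & classical || (size p.2 <= 1)].
Proof. by rewrite okE => /andP[/andP[]]. Qed.

(** Reduces well-formedness of a sequent to that of the elements, tests and
   formulae in the context, and the size of its succedent to theirs. *)
Ltac ok_tac :=
  repeat match goal with
  | H : is_true (elt ?p) |- _ => move/elt_split: H => [? ? ?]
  | H : is_true (ok ?p) |- _ => move/ok_splitp: H => [? ? ?]
  end;
  rewrite ?ok_split ?okE /elt /LK_sequent /nilp /= ?all_cat ?size_cat /=;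
  repeat match goal with
  | H : is_true _ |- _ => move: H
  end;
  rewrite /is_formula /=; case: classical => /= *;
  repeat match goal with
  | H : is_true (_ && _) |- _ => case/andP: H => *
  end;
  repeat match goal with
  | H : is_true (size _ == 0) |- _ => rewrite (eqP H) /=
  end;
  rewrite ?addn0 ?andbT; 
  repeat (apply/andP; split); done.

(** A rule prescribes where its active formulae stand in a sequent, whereas
    merging contexts places them elsewhere; premises and conclusion are therefore
    matched up to structural rules. *)
Lemma provable_rule1 p p' c q : gentzen_rule [:: p'] c ->
  sub_sequent p p' -> ok p' ->
  sub_sequent c q -> ok c -> ok q -> provable p -> provable q.
Proof.
move=> Hr Hpp Hp' Hcq Hc Hq Hp; apply: (provable_mono Hcq Hq).
by apply: (provable1 Hc Hr); apply: provable_mono Hp.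
Qed.

Lemma provable_rule2 p1 p2 p1' p2' c q : gentzen_rule [:: p1'; p2'] c ->
  sub_sequent p1 p1' -> ok p1' -> sub_sequent p2 p2' -> ok p2' ->
  sub_sequent c q -> ok c -> ok q -> provable p1 -> provable p2 -> provable q.
Proof.
move=> Hr H1 Hok1 H2 Hok2 Hcq Hc Hq HP1 HP2; apply: (provable_mono Hcq Hq).
apply: (provable2 Hc Hr); first exact: provable_mono HP1.
exact: provable_mono HP2.
Qed.

Lemma provable_Ax A : is_formula A -> provable (merge (lhs A) (rhs A)).
Proof. by move=> HA; apply: provable0 (Ax A); ok_tac. Qed.

Lemma provable_NegL p A : elt p -> is_formula A -> provable (merge p (rhs A)) ->
  provable (merge (lhs (Neg A)) p).
Proof.
by move=> Hp HA; apply: (provable_rule1 (NegL p.1 p.2 A)); (sub_tac || ok_tac).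
Qed.

Lemma provable_NegR p A : elt p -> is_formula A -> provable (merge p (lhs A)) ->
  provable (merge p (rhs (Neg A))).
Proof.
by move=> Hp HA; apply: (provable_rule1 (NegR p.1 p.2 A)); (sub_tac || ok_tac).
Qed.

Lemma provable_AndL1 q A B : ok q -> is_formula (And A B) ->
  provable (merge (lhs A) q) -> provable (merge (lhs (And A B)) q).
Proof.
by move=> Hq H; apply: (provable_rule1 (AndL1 q.1 q.2 A B)); (sub_tac || ok_tac).
Qed.

Lemma provable_AndL2 q A B : ok q -> is_formula (And A B) ->
  provable (merge (lhs B) q) -> provable (merge (lhs (And A B)) q).
Proof.
by move=> Hq H; apply: (provable_rule1 (AndL2 q.1 q.2 A B)); (sub_tac || ok_tac).
Qed.

Lemma provable_AndR p A B : elt p -> is_formula (And A B) ->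
  provable (merge p (rhs A)) -> provable (merge p (rhs B)) ->
  provable (merge p (rhs (And A B))).
Proof.
by move=> Hp H; apply: (provable_rule2 (AndR p.1 p.2 A B)); (sub_tac || ok_tac).
Qed.

Lemma provable_OrL q A B : ok q -> is_formula (Or A B) ->
  provable (merge (lhs A) q) -> provable (merge (lhs B) q) ->
  provable (merge (lhs (Or A B)) q).
Proof.
by move=> Hq H; apply: (provable_rule2 (OrL q.1 q.2 A B)); (sub_tac || ok_tac).
Qed.

Lemma provable_OrR1 p A B : elt p -> is_formula (Or A B) ->
  provable (merge p (rhs A)) -> provable (merge p (rhs (Or A B))).
Proof.
by move=> Hp H; apply: (provable_rule1 (OrR1 p.1 p.2 A B)); (sub_tac || ok_tac).
Qed.

Lemma provable_OrR2 p A B : elt p -> is_formula (Or A B) ->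
  provable (merge p (rhs B)) -> provable (merge p (rhs (Or A B))).
Proof.
by move=> Hp H; apply: (provable_rule1 (OrR2 p.1 p.2 A B)); (sub_tac || ok_tac).
Qed.

Lemma provable_ImpL p q A B : elt p -> ok q -> is_formula (Imp A B) ->
  provable (merge p (rhs A)) -> provable (merge (lhs B) q) ->
  provable (merge (lhs (Imp A B)) (merge p q)).
Proof.
by move=> Hp Hq H; apply: (provable_rule2 (ImpL p.1 q.1 p.2 q.2 A B));
  (sub_tac || ok_tac).
Qed.

Lemma provable_ImpR p A B : elt p -> is_formula (Imp A B) ->
  provable (merge p (merge (lhs A) (rhs B))) ->
  provable (merge p (rhs (Imp A B))).
Proof.
by move=> Hp H; apply: (provable_rule1 (ImpR p.1 p.2 A B)); (sub_tac || ok_tac).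
Qed.

Lemma provable_AllL q x A t : ok q -> is_formula (All x A) ->
  provable (merge (lhs (inst x t A)) q) -> provable (merge (lhs (All x A)) q).
Proof.
move=> Hq H; have HA := is_formula_inst t H.
by apply: (provable_rule1 (AllL q.1 q.2 x A t)); (sub_tac || ok_tac).
Qed.

Lemma provable_ExR p x A t : elt p -> is_formula (Ex x A) ->
  provable (merge p (rhs (inst x t A))) -> provable (merge p (rhs (Ex x A))).
Proof.
move=> Hq H; have HA := is_formula_inst t H.
by apply: (provable_rule1 (ExR p.1 p.2 x A t)); (sub_tac || ok_tac).
Qed.

(** Derivability of all instances is assumed, so that the choice of an
    eigenvariable fresh for [p] is made here once and for all. *)
Lemma provable_AllR p x A : elt p -> is_formula (All x A) ->
  (forall t, provable (merge p (rhs (inst x t A)))) ->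
  provable (merge p (rhs (All x A))).
Proof.
move=> Hq H HP.
have [v Hv] := sequent_fresh (p.1 ⟹ (p.2 ++ [:: All x A])).
have HA := is_formula_inst (Free v) H.
by apply: provable_rule1 (AllR Hv) _ _ _ _ _ (HP (Free v)); (sub_tac || ok_tac).
Qed.

Lemma provable_ExL q x A : ok q -> is_formula (Ex x A) ->
  (forall t, provable (merge (lhs (inst x t A)) q)) ->
  provable (merge (lhs (Ex x A)) q).
Proof.
move=> Hq H HP.
have [v Hv] := sequent_fresh ((q.1 ++ [:: Ex x A]) ⟹ q.2).
have HA := is_formula_inst (Free v) H.
by apply: provable_rule1 (ExL Hv) _ _ _ _ _ (HP (Free v)); (sub_tac || ok_tac).
Qed.

Lemma provable_refl t : provable (rhs (Eq t t)).
Proof.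
apply: (@Infer _ _ _ [::]); last by [].
  by rewrite ok_rhs /is_formula /= tm_scoped_emb.
by right; constructor.
Qed.

Lemma is_formula_eq r s : is_formula (Eq r s).
Proof. by rewrite /is_formula /= !tm_scoped_emb. Qed.

(** The equality rule with the axiom B ⟹ B as its second premise. *)
Lemma provable_eq e r s A B : elt e -> is_formula A -> is_formula B ->
  atom_rep r s A B -> provable (merge e (rhs A)) ->
  provable (merge (lhs (Eq r s)) (merge e (rhs B))).
Proof.
move=> He HA HB /atom_rep_context[F [v [EA EB]]] HP.
have Hrs := is_formula_eq r s.
have R := EqL e.1 e.2 [::] [:: B] F v r s; rewrite -EA -EB in R.
apply: (@provable_mono ((e.1 ++ [::] ++ [:: Eq r s]) ⟹ (e.2 ++ [:: B])));
  [sub_tac|ok_tac|].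
apply: (Infer _ (or_intror R)); first by ok_tac.
move=> _ [<-|[<-|[]]]; last exact: provable_Ax.
by apply: (provable_mono _ _ HP); [sub_tac|ok_tac].
Qed.

(** Replacement against the direction of the equation: the equality rule,
    applied to the reflexivity axiom ⟹ r = r, replaces s = r in the antecedent
    by r = s. *)
Lemma provable_eq_sym e r s A B : elt e -> is_formula A -> is_formula B ->
  atom_rep s r A B -> provable (merge e (rhs A)) ->
  provable (merge (lhs (Eq r s)) (merge e (rhs B))).
Proof.
move=> He HA HB Hrep HP.
have Hrs := is_formula_eq r s; have Hsr := is_formula_eq s r.
have Hrr := is_formula_eq r r.
have /atom_rep_context[F [v [EA EB]]] : atom_rep r s (Eq r r) (Eq s r).
  by constructor; [exact: RepHere|exact: RepRefl].
have R := EqL [::] [::] e.1 (e.2 ++ [:: B]) F v r s; rewrite -EA -EB in R.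
apply: (@provable_mono ((e.1 ++ [:: Eq r s]) ⟹ (e.2 ++ [:: B])));
  [sub_tac|ok_tac|].
apply: (Infer _ (or_intror R)); first by ok_tac.
move=> _ [<-|[<-|[]]]; first exact: provable_refl.
by apply: (provable_mono _ _ (provable_eq He HA HB Hrep HP)); [sub_tac|ok_tac].
Qed.

Lemma ok_formula e A : ok (merge e (rhs A)) -> is_formula A.
Proof.
by rewrite okE /LK_sequent /= !all_cat /= !andbT => /andP[/and3P[]].
Qed.

Lemma provable_formula e A : provable (merge e (rhs A)) -> is_formula A.
Proof.
exact: (fun H => ok_formula (provable_ok H)).
Qed.

Lemma form_map_inst x t th A :
  form_map (tm_inst x t \o th) A = inst x t (form_map th A).
Proof. by rewrite inst_map form_map_comp. Qed.

(** By induction on [A]; each half uses the rule that introduces the outermost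
    symbol of [A] on the corresponding side, applied to the contexts given by
    the induction hypotheses for the immediate subformulae. *)
Lemma val_self A th : is_formula (form_map th A) ->
  val A th (lhs (form_map th A)) /\ coval A th (rhs (form_map th A)).
Proof.
elim: A th => [u u'|P a|A IH|A IHA B IHB|A IHA B IHB|A IHA B IHB|x A IH|x A IH]
  th; rewrite [form_map _ _]/= => HF;
  rewrite /coorth /= ok_rhs ?/orth ?elt_lhs HF.
- have /andP[/scoped_term[r Er] /scoped_term[s Es]] := HF.
  rewrite Er Es; split.
    split=> // q [] [A [B [e [He Hrep HP ->]]]] Hok.
      exact: (provable_eq He (provable_formula HP) (ok_formula Hok) Hrep HP).
    exact: (provable_eq_sym He (provable_formula HP) (ok_formula Hok) Hrep HP).
  split=> // p [Hp]; apply; last by rewrite ok_rhs is_formula_eq.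
  left; exists (Eq r r), (Eq r s), ([::] ⟹ [::]); split=> //.
  - exact: elt0.
  - by constructor; [exact: RepRefl|exact: RepHere].
  - exact: provable_refl.
- split; last by split=> // p [Hp]; apply; rewrite ?ok_rhs.
  by split=> // q -> _; apply: provable_Ax.
- have [H1 [_ H2]] := IH th HF; split; split=> //.
    by move=> q Hq _; apply: provable_NegL => //; [exact: val_elt Hq|exact: H2].
  move=> p [Hp HP]; apply: provable_NegR => //; apply: HP => //.
  by apply: elt_ok; rewrite elt_lhs.
- have /andP[/IHA[HA [_ HA']] /IHB[HB [_ HB']]] := HF; split.
    split; apply: val_closed; rewrite ?elt_lhs // => q Hq.
      by apply: (provable_AndL1 (coval_ok Hq)) => //; exact: val_coval Hq.
    by apply: (provable_AndL2 (coval_ok Hq)) => //; exact: val_coval Hq.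
  split=> // p [HpA HpB]; apply: provable_AndR; rewrite ?(val_elt HpA) //.
    exact: HA'.
  exact: HB'.
- have /andP[/IHA[HA [_ HA']] /IHB[HB [_ HB']]] := HF; split.
    split=> // q [HqA HqB] Hq; apply: provable_OrL => //;
      [exact: val_coval HqA|exact: val_coval HqB].
  split=> // p [Hp]; apply; rewrite ?ok_rhs //.
  split; split; rewrite ?ok_rhs // => p' Hp'.
    by apply: provable_OrR1; [exact: val_elt Hp'|by []|exact: HA'].
  by apply: provable_OrR2; [exact: val_elt Hp'|by []|exact: HB'].
- have /andP[HwA HwB] := HF.
  have [[HA [_ HA']] [HB HB']] := (IHA _ HwA, IHB _ HwB); split.
    split=> // q [a [k [Ha Hk ->]]] _; apply: provable_ImpL => //.
    - exact: val_elt Ha.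
    - exact: coval_ok Hk.
    - exact: HA'.
    - exact: val_coval Hk.
  split=> // p [Hp HP]; apply: provable_ImpR => //; apply: HP.
    by exists (lhs (form_map th A)), (rhs (form_map th B)).
  by rewrite ok_merge ?elt_lhs ?ok_rhs.
- have IHt t := IH (tm_inst x t \o th); split.
    move=> t; have := IHt t; rewrite form_map_inst.
    case/(_ (is_formula_inst t HF)) => Ht _.
    apply: val_closed => [|q Hq]; first by rewrite elt_lhs.
    by apply: (provable_AllL (t := t) (coval_ok Hq)) => //; apply: val_coval Hq.
  split=> // p Hp; apply: provable_AllR => //.
    exact: (val_elt (Hp (Free 0))).
  move=> t; have := IHt t; rewrite form_map_inst.
  by case/(_ (is_formula_inst t HF)) => _ [_]; apply.
- have IHt t := IH (tm_inst x t \o th); split.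
    split=> // q Hq Hok; apply: provable_ExL => // t.
    have := IHt t; rewrite form_map_inst.
    by case/(_ (is_formula_inst t HF)) => Ht _; apply: val_coval (Hq t).
  split=> // p [Hp]; apply; rewrite ?ok_rhs // => t.
  have := IHt t; rewrite form_map_inst.
  case/(_ (is_formula_inst t HF)) => _ [_ Ht].
  split=> [|p' Hp']; first by rewrite ok_rhs.
  by apply: (@provable_ExR _ _ _ t) => //; [exact: val_elt Hp'|exact: Ht].
Qed.

(** * Congruence *)

Definition equates w w' p : Prop :=
  orth (fun q => leibniz w w' q \/ leibniz w' w q) p.

Lemma equates_sym w w' p : equates w w' p -> equates w' w p.
Proof. by case=> Hp H; split=> // q Hq; apply: H; case: Hq; auto. Qed.

Lemma mergeA p q e : merge p (merge q e) = merge (merge p q) e.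
Proof. by rewrite /merge /= !catA. Qed.

Lemma equates_rep w w' p e A B : equates w w' p -> tm_scoped [::] w' ->
  elt e -> atom_rep w w' A B -> provable (merge e (rhs A)) ->
  provable (merge (merge p e) (rhs B)).
Proof.
move=> [Hp H] Hw He Hrep HP; rewrite -mergeA; apply: H.
  by left; exists A, B, e.
rewrite ok_merge ?ok_rhs //.
exact: atom_rep_formula Hw Hrep (provable_formula HP).
Qed.

(** Replacement of r by s transports values, at the cost of a copy of an element
    [p] of the value of r = s.  The induction needs both directions, because
    negation and implication exchange them; the copies of [p] that accumulate
    are contracted. *)
Lemma val_rep A th th' r s p e : equates r s p ->
  (forall u, rep r s (th u) (th' u)) ->
  is_formula (form_map th A) -> is_formula (form_map th' A) ->
  val A th e -> val A th' (merge p e).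
Proof.
elim: A th th' r s e =>
  [u u'|P a|A IH|A IHA B IHB|A IHA B IHB|A IHA B IHB|x A IH|x A IH]
  th th' r s e Hrs Hrep Hth Hth' He;
  have Hp := Hrs.1; have Hsr := equates_sym Hrs;
  have Hrep' u0 := rep_sym (Hrep u0); have Hee := val_elt He;
  have Hpe := elt_merge Hp Hee; rewrite /= in Hth Hth' He *.
- have /andP[Su Su'] := Hth; split=> // q Hq Hok.
  have {Hq} [z [z' [A [B [e' [He' Hz Hz' [HA [HP Eq]]]]]]]] :
      exists z z' A B e', [/\ elt e', equates (th z) (th z') e,
        tm_scoped [::] (th z') & atom_rep (th' z) (th' z') A B /\
        provable (merge e' (rhs A)) /\ q = merge e' (rhs B)].
    by case: Hq => -[A [B [e' [? ? ? ->]]]]; [exists u, u'|exists u', u];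
      exists A, B, e'; split=> //; exact: equates_sym.
  rewrite Eq in Hok *.
  (* The replacement of th' z by th' z' is carried out as: back to th z, then
     to th z' by the equation in the context [e], then to th' z'. *)
  have [A' [B' [H1 H2 H3]]] := atom_rep_factor (Hrep' z) (Hrep z') HA.
  have P1 := equates_rep Hsr (tm_scoped_emb _ _) He' H1 HP.
  have P2 := equates_rep Hz Hz' (elt_merge Hp He') H2 P1.
  have P3 := equates_rep Hrs (tm_scoped_emb _ _)
    (elt_merge Hee (elt_merge Hp He')) H3 P2.
  by apply: (provable_mono _ _ P3); [sub_tac|exact: ok_merge].
- split=> // q -> Hok; case: He => _ /(_ _ erefl); rewrite ok_rhs => /(_ Hth).
  apply: (equates_rep Hrs) => //; first exact: tm_scoped_emb.
  by apply: RepPred => i; rewrite !ffunE.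
- split=> // q Hq Hok; case: He => _ /(_ _ (IH _ _ _ _ _ Hsr Hrep' Hth' Hth Hq)).
  have Hpq := elt_merge Hp (val_elt Hq).
  move/(_ (elt_ok Hpq)) => HP.
  by apply: (provable_mono _ _ HP); [sub_tac|exact: ok_merge].
- have /andP[HA HB] := Hth; have /andP[HA' HB'] := Hth'.
  case: He => HeA HeB; split; first exact: (IHA _ _ _ _ _ Hrs Hrep HA HA' HeA).
  exact: (IHB _ _ _ _ _ Hrs Hrep HB HB' HeB).
- have /andP[HA HB] := Hth; have /andP[HA' HB'] := Hth'.
  split=> // q [HqA HqB] Hok; case: He => _ /(_ (merge p q)) HP.
  have Hpq := ok_merge Hp Hok.
  apply: (@provable_mono (merge e (merge p q))); [sub_tac|exact: ok_merge|].
  apply: HP => //; split; split=> // e' He'.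
    have He2 := IHA _ _ _ _ _ Hrs Hrep HA HA' He'.
    apply: (provable_mono _ _ (val_coval He2 HqA));
      [sub_tac|exact: ok_merge (val_elt He') Hpq].
  have He2 := IHB _ _ _ _ _ Hrs Hrep HB HB' He'.
  apply: (provable_mono _ _ (val_coval He2 HqB));
    [sub_tac|exact: ok_merge (val_elt He') Hpq].
- have /andP[HA HB] := Hth; have /andP[HA' HB'] := Hth'.
  split=> // _ [a [k [Ha Hk ->]]] Hok; case: He => _.
  have Hpa := IHA _ _ _ _ _ Hsr Hrep' HA' HA Ha.
  have Hpk := ok_merge Hp (coval_ok Hk).
  move/(_ (merge (merge p a) (merge p k))) => HP.
  apply: (@provable_mono (merge e (merge (merge p a) (merge p k))));
    [sub_tac|exact: ok_merge|].
  apply: HP; last exact: ok_merge (val_elt Hpa) Hpk.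
  exists (merge p a), (merge p k); split=> //; split=> // e' He'.
  have He2 := IHB _ _ _ _ _ Hrs Hrep HB HB' He'.
  apply: (provable_mono _ _ (val_coval He2 Hk));
    [sub_tac|exact: ok_merge (val_elt He') Hpk].
- move=> t; apply: (IH _ _ _ _ _ Hrs _ _ _ (He t)).
  + by move=> u; apply: rep_inst.
  + by rewrite form_map_inst; apply: is_formula_inst Hth.
  + by rewrite form_map_inst; apply: is_formula_inst Hth'.
- split=> // q Hq Hok; case: He => _ /(_ (merge p q)) HP.
  have Hpq := ok_merge Hp Hok.
  apply: (@provable_mono (merge e (merge p q))); [sub_tac|exact: ok_merge|].
  apply: HP => // t; split=> // e' He'.
  have He2 : val A (tm_inst x t \o th') (merge p e').
    apply: (IH _ _ _ _ _ Hrs _ _ _ He').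
    + by move=> u; apply: rep_inst.
    + by rewrite form_map_inst; apply: is_formula_inst Hth.
    + by rewrite form_map_inst; apply: is_formula_inst Hth'.
  apply: (provable_mono _ _ (val_coval He2 (Hq t)));
    [sub_tac|exact: ok_merge (val_elt He') Hpq].
Qed.

(** * Soundness *)

Section Soundness.
Variable sg : nat -> term Sg.

Definition vals (G : seq (form Sg)) p :=
  elt p /\ forall A, List.In A G -> val A (tm_subst sg) p.
Definition covals (D : seq (form Sg)) q :=
  ok q /\ forall B, List.In B D -> coval B (tm_subst sg) q.
(** A single element in the values of all antecedent formulae replaces a family
    of elements, one for each formula, because contexts can be weakened and
    contracted.  The same applies to tests. *)
Definition valid (S : sequent Sg) := forall p q,
  vals S.1 p -> covals S.2 q -> provable (merge p q).

Lemma vals_cat G L p : vals (G ++ L) p <-> vals G p /\ vals L p.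
Proof.
split=> [[Hp H]|[[Hp H] [_ H']]].
  by split; split=> // A HA; apply: H; rewrite In_cat; auto.
by split=> // A /In_cat[]; auto.
Qed.

Lemma vals1 A p : vals [:: A] p <-> val A (tm_subst sg) p.
Proof.
by split=> [[_]|H]; [apply; left|split; [exact: val_elt H|move=> _ [<-|[]]]].
Qed.

Lemma covals_cat D T q : covals (D ++ T) q <-> covals D q /\ covals T q.
Proof.
split=> [[Hp H]|[[Hp H] [_ H']]].
  by split; split=> // A HA; apply: H; rewrite In_cat; auto.
by split=> // A /In_cat[]; auto.
Qed.

Lemma covals1 A q : covals [:: A] q <-> coval A (tm_subst sg) q.
Proof.
by split=> [[_]|H]; [apply; left|split; [exact: coval_ok H|move=> _ [<-|[]]]].
Qed.

Lemma vals_mergel G p q : elt q -> vals G p -> vals G (merge p q).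
Proof.
by move=> Hq [Hp H]; split=> [|A /H]; [exact: elt_merge|exact: val_mergel].
Qed.

Lemma covals_mergel D q k : elt q -> ok k -> covals D q -> covals D (merge q k).
Proof.
move=> Hq Hk [_ H]; have Hqk := ok_merge Hq Hk; split=> // B /H.
by apply: coval_sub => //; sub_tac.
Qed.

(** When the succedent has room for one more formula, a test for [D] contains
    an element: it is itself one in LK, and [D] is empty in LJ, where the empty
    sequent serves. *)
Lemma covals_elt D A G q : ok (G ⟹ (D ++ [:: A])) -> covals D q ->
  exists q', [/\ elt q', sub_sequent q' q & covals D q'].
Proof.
rewrite okE => /andP[_]; case Hc : classical => /= Hsize Hq.
  exists q; split=> //; last by split.
  by have := Hq.1; rewrite okE /elt Hc /= !andbT.
exists ([::] ⟹ [::]); rewrite elt0; split=> //.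
  by split.
case: D Hsize {Hq} => [|B D]; last by rewrite /= size_cat addn1.
by split=> //; apply: elt_ok elt0.
Qed.

(** Together with [valid_rhs], this treats a formula of the succedent as the
    single conclusion, the rest [D] being moved into the element.  It is what
    makes one argument serve for LJ and LK. *)
Lemma valid_val G D A p q : valid (G ⟹ (D ++ [:: A])) ->
  vals G p -> elt q -> covals D q -> val A (tm_subst sg) (merge p q).
Proof.
move=> HV Hp Hq Hcq; apply: val_closed; first exact: elt_merge Hp.1 Hq.
move=> k Hk; rewrite -mergeA; apply: HV => //.
apply/covals_cat; split; first exact: covals_mergel (coval_ok Hk) Hcq.
apply/covals1; apply: (coval_sub _ _ Hk); last by sub_tac.
exact: ok_merge (coval_ok Hk).
Qed.

Lemma valid_rhs G D A : ok (G ⟹ (D ++ [:: A])) ->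
  (forall p q, vals G p -> elt q -> covals D q ->
    val A (tm_subst sg) (merge p q)) -> valid (G ⟹ (D ++ [:: A])).
Proof.
move=> Hok H p q /= Hp /covals_cat[/(covals_elt Hok)[q' [Hq' [S1 S2] HD]]].
move/covals1=> HA; have HP := val_coval (H p q' Hp Hq' HD) HA.
apply: (provable_mono _ _ HP); last exact: ok_merge Hp.1 (coval_ok HA).
split=> x; rewrite /= !In_cat; [have := S1 x|have := S2 x]; tauto.
Qed.

Lemma valid_coval G D A p q : valid ((G ++ [:: A]) ⟹ D) ->
  vals G p -> covals D q -> coval A (tm_subst sg) (merge p q).
Proof.
move=> HV Hp Hq; have Hpq := ok_merge Hp.1 Hq.1; split=> // a Ha.
apply: (@provable_mono (merge (merge p a) q));
  [by sub_tac|exact: ok_merge (val_elt Ha) Hpq|].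
apply: HV => //; apply/vals_cat; split; first exact: vals_mergel (val_elt Ha) Hp.
by apply/vals1; apply: val_merger Hp.1 Ha.
Qed.

Lemma valid_lhs G D A : (forall p q, vals G p -> covals D q ->
    val A (tm_subst sg) p -> provable (merge p q)) -> valid ((G ++ [:: A]) ⟹ D).
Proof. by move=> H p q /= /vals_cat[Hp /vals1 HA] Hq; apply: H. Qed.

Lemma valid_incl G D G' D' : List.incl G G' -> List.incl D D' ->
  valid (G ⟹ D) -> valid (G' ⟹ D').
Proof.
move=> HG HD HV p q /= [Hp Hp'] [Hq Hq']; apply: HV.
  by split=> // A /HG/Hp'.
by split=> // A /HD/Hq'.
Qed.

End Soundness.

Lemma formula_fresh (G : seq (form Sg)) v A :
  ~~ has (occurs v) G -> List.In A G -> ~~ occurs v A.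
Proof. by rewrite -all_predC => HG HA; exact: (all_In HG HA). Qed.

(** The values of the maps on terms that contain [v] are irrelevant when [v]
    does not occur in the formula.  This is the use made of eigenvariable
    conditions. *)
Lemma form_map_fresh v A th th' : ~~ occurs v A ->
  (forall u, ~~ tm_occurs v u -> th u = th' u) -> form_map th A = form_map th' A.
Proof.
move=> HA H; elim: A HA => /=
  [u u'|P a|A IH|A IHA B IHB|A IHA B IHB|A IHA B IHB|x A IH|x A IH];
  rewrite ?negb_or.
- by case/andP=> Hu Hu'; rewrite !H.
- rewrite negb_exists => /forallP Ha; congr Pred.
  by apply/ffunP=> i; rewrite !ffunE H.
- by move/IH->.
- by case/andP=> /IHA-> /IHB->.
- by case/andP=> /IHA-> /IHB->.
- by case/andP=> /IHA-> /IHB->.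
- by move/IH->.
- by move/IH->.
Qed.

Lemma vals_update sg v t G p : ~~ has (occurs v) G ->
  vals sg G p -> vals (update sg v t) G p.
Proof.
move=> HG [Hp H]; split=> // A HA; apply: val_eq (H A HA).
apply: (form_map_fresh (formula_fresh HG HA)) => u Hu.
by rewrite tm_subst_update.
Qed.

Lemma covals_update sg v t D q : ~~ has (occurs v) D ->
  covals sg D q -> covals (update sg v t) D q.
Proof.
move=> HD [Hq H]; split=> // A HA; apply: coorth_anti (H A HA) => p.
apply: val_eq; apply: (form_map_fresh (formula_fresh HD HA)) => u Hu.
by rewrite tm_subst_update.
Qed.

Lemma form_map_inst_subst sg x t t' A : tm_subst sg (emb t) = emb t' ->
  form_map (tm_subst sg) (inst x t A) = form_map (tm_inst x t' \o tm_subst sg) A.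
Proof.
move=> Ht; rewrite inst_map form_map_comp.
have [v Hv] := form_fresh A; apply: (form_map_fresh (Hv v (leqnn v))) => u _ /=.
exact: tm_subst_inst.
Qed.

(** Giving the value [t] to an eigenvariable turns the premise of a quantifier
    rule into the instance at [t]. *)
Lemma form_map_inst_update sg v x t A : ~~ occurs v A ->
  form_map (tm_subst (update sg v t)) (inst x (Free v) A) =
  form_map (tm_inst x t \o tm_subst sg) A.
Proof.
move=> HA; rewrite (@form_map_inst_subst _ _ _ t); last first.
  by rewrite /= /update eqxx.
by apply: (form_map_fresh HA) => u Hu /=; rewrite tm_subst_update.
Qed.

Ltac incl_tac := by move=> ?; rewrite ?In_cat /= ?In_cat /=; tauto.

(** Structural rules hold because only membership of formulae in a sequent
    matters for validity.  For a logical rule, the premises place the context in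
    the values (for a succedent formula) or covalues (for an antecedent formula)
    of the subformulae, and the definition of [val] does the rest; duplicated
    contexts are contracted by [provable_mono]. *)
Lemma gentzen_sound ps c : gentzen_rule ps c -> ok c ->
  (forall p, List.In p ps -> ok p /\ forall sg, valid sg p) ->
  forall sg, valid sg c.
Proof.
case=> {ps c}
  [F|G D F|G D F|G L D E F|G D T E F|G D F|G D F|G D A|G D A|G D A B|G D A B
  |G D A B|G D A B|G D A B|G D A B|G L D T A B|G D A B|G D x A t|G D x A v Hv
  |G D x A v Hv|G D x A t] Hok HV sg;
  try have [O1 V1] := HV _ (or_introl erefl);
  try have [O2 V2] := HV _ (or_intror (or_introl erefl)).
- by move=> p q /vals1 Hp /covals1 Hq; apply: val_coval Hq.
- by apply: valid_incl (V1 sg); incl_tac.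
- by apply: valid_incl (V1 sg); incl_tac.
- by apply: valid_incl (V1 sg); incl_tac.
- by apply: valid_incl (V1 sg); incl_tac.
- by apply: valid_incl (V1 sg); incl_tac.
- by apply: valid_incl (V1 sg); incl_tac.
- apply: valid_lhs => p q Hp Hq [_ HA].
  have [q' [Hq' [S1 S2] Hcq']] := covals_elt O1 Hq.
  have Ha := valid_val (V1 sg) Hp Hq' Hcq'.
  have HP := HA _ Ha (elt_ok (val_elt Ha)).
  apply: (provable_mono _ _ HP); last exact: ok_merge Hp.1 Hq.1.
  by split=> x; rewrite /= !In_cat; [have := S1 x|have := S2 x]; tauto.
- apply: (valid_rhs Hok) => p q Hp Hq Hcq; split; first exact: elt_merge Hp.1 Hq.
  move=> a Ha Hoka; have [_ /(_ a Ha)] := valid_coval (V1 sg) Hp Hcq => HP.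
  apply: (provable_mono _ _ HP); first by sub_tac.
  by apply: ok_merge => //; exact: elt_merge Hp.1 Hq.
- apply: valid_lhs => p q Hp Hq [HA _].
  have HP := val_coval HA (valid_coval (V1 sg) Hp Hq).
  by apply: (provable_mono _ _ HP); [sub_tac|exact: ok_merge Hp.1 Hq.1].
- apply: valid_lhs => p q Hp Hq [_ HA].
  have HP := val_coval HA (valid_coval (V1 sg) Hp Hq).
  by apply: (provable_mono _ _ HP); [sub_tac|exact: ok_merge Hp.1 Hq.1].
- by apply: (valid_rhs Hok) => p q Hp Hq Hcq; split; apply: valid_val.
- apply: valid_lhs => p q Hp Hq [_ HA].
  have HcA := valid_coval (V1 sg) Hp Hq; have HcB := valid_coval (V2 sg) Hp Hq.
  have HP := HA _ (conj HcA HcB) (coval_ok HcA).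
  by apply: (provable_mono _ _ HP); [sub_tac|exact: ok_merge Hp.1 Hq.1].
- apply: (valid_rhs Hok) => p q Hp Hq Hcq; split; first exact: elt_merge Hp.1 Hq.
  by move=> k [Hk _] _; apply: val_coval Hk; apply: valid_val (V1 sg) _ _ _.
- apply: (valid_rhs Hok) => p q Hp Hq Hcq; split; first exact: elt_merge Hp.1 Hq.
  by move=> k [_ Hk] _; apply: val_coval Hk; apply: valid_val (V1 sg) _ _ _.
- rewrite catA; apply: valid_lhs => p q /vals_cat[HG HL].
  case/covals_cat=> HD HT [_ HA].
  have [q' [Hq' [S1 S2] Hcq']] := covals_elt O1 HD.
  have Ha := valid_val (V1 sg) HG Hq' Hcq'.
  have Hb := valid_coval (V2 sg) HL HT.
  have HP := HA (merge (merge p q') (merge p q)) _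
    (ok_merge (val_elt Ha) (coval_ok Hb)).
  apply: (provable_mono _ _ (HP _)); last by exists (merge p q'), (merge p q).
    by split=> x; rewrite /= !In_cat; [have := S1 x|have := S2 x]; tauto.
  exact: ok_merge HG.1 HD.1.
- apply: (valid_rhs Hok) => p q Hp Hq Hcq; split; first exact: elt_merge Hp.1 Hq.
  move=> _ [a [k [Ha Hk ->]]] Hokak.
  have HB := valid_val (V1 sg) _ Hq Hcq.
  have HP := val_coval (HB (merge p a) _) Hk.
  apply: (provable_mono _ _ (HP _)).
  + by sub_tac.
  + by apply: ok_merge => //; exact: elt_merge Hp.1 Hq.
  + apply/vals_cat; split; first exact: vals_mergel (val_elt Ha) Hp.
    by apply/vals1; apply: val_merger Hp.1 Ha.
- apply: valid_lhs => p q Hp Hq HA; have [t' Ht'] := tm_subst_emb sg t.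
  have Ha : val (inst x t A) (tm_subst sg) p.
    by apply: val_eq (HA t'); rewrite (form_map_inst_subst _ _ Ht').
  have HP := val_coval Ha (valid_coval (V1 sg) Hp Hq).
  by apply: (provable_mono _ _ HP); [sub_tac|exact: ok_merge Hp.1 Hq.1].
- move: Hv; rewrite /seq_occurs has_cat /= orbF !negb_or => /and3P[HvG HvD HvA].
  apply: (valid_rhs Hok) => p q Hp Hq Hcq t.
  have := valid_val (V1 (update sg v t)) (vals_update t HvG Hp) Hq
    (covals_update t HvD Hcq).
  by apply: val_eq; rewrite form_map_inst_update.
- move: Hv; rewrite /seq_occurs has_cat /= orbF !negb_or.
  case/andP=> /andP[HvG HvA] HvD.
  apply: valid_lhs => p q Hp Hq [_ HA].
  have Hpq := ok_merge Hp.1 Hq.1.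
  apply: (provable_mono _ _ (HA (merge p q) _ Hpq)) => //; first by sub_tac.
  move=> t.
  have := valid_coval (V1 (update sg v t)) (vals_update t HvG Hp)
    (covals_update t HvD Hq).
  by apply: coorth_anti => e; apply: val_eq; rewrite form_map_inst_update.
- have [t' Ht'] := tm_subst_emb sg t.
  apply: (valid_rhs Hok) => p q Hp Hq Hcq; split; first exact: elt_merge Hp.1 Hq.
  move=> k /(_ t') Hk _; apply: val_coval Hk.
  have := valid_val (V1 sg) Hp Hq Hcq.
  by apply: val_eq; rewrite (form_map_inst_subst _ _ Ht').
Qed.

(** The equality rule is a cut on F{v/s} once replacement has moved the context
    of the first premise from the value of F{v/r} to that of F{v/s}. *)
Lemma eq1_sound ps c : eq1_rule ps c -> ok c ->
  (forall p, List.In p ps -> ok p /\ forall sg, valid sg p) ->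
  forall sg, valid sg c.
Proof.
case=> {ps c} [r|L T G D F v r s] Hok HV sg.
  have [r' Hr'] := tm_subst_emb sg r.
  move=> p q Hp /covals1 Hq.
  (* Replacing r by itself changes nothing, so any element passes by weakening. *)
  have : val (Eq r r) (tm_subst sg) p.
    split; first exact: Hp.1.
    rewrite /= Hr' => k Hk Hokk.
    have [A [B [e [He /atom_rep_refl <- HP Ek]]]] : leibniz r' r' k by case: Hk.
    apply: (provable_mono _ _ HP); last exact: ok_merge Hp.1 Hokk.
    by rewrite Ek; sub_tac.
  by move=> H; exact: val_coval H Hq.
have [O1 V1] := HV _ (or_introl erefl).
have [O2 V2] := HV _ (or_intror (or_introl erefl)).
rewrite catA; apply: valid_lhs => p q /vals_cat[HL HG] /covals_cat[HT HD] HE.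
have [r' Hr'] := tm_subst_emb sg r; have [s' Hs'] := tm_subst_emb sg s.
have [q' [Hq' [S1 S2] Hcq']] := covals_elt O1 HT.
have Hr := valid_val (V1 sg) HL Hq' Hcq'.
have Hs := valid_coval (V2 sg) HG HD.
rewrite /= Hr' Hs' in HE.
have Fr : is_formula (fsubst v r F).
  by move: O1; rewrite okE /LK_sequent /= all_cat /= => /andP[/and4P[]].
have Fs : is_formula (fsubst v s F).
  by move: O2; rewrite okE /LK_sequent /= all_cat /= => /andP[/andP[/and3P[]]].
have E t : form_map (tm_subst sg) (fsubst v t F) =
    form_map (tm_subst sg \o tm_fsubst v t) F by rewrite fsubst_map form_map_comp.
have W t : is_formula (fsubst v t F) ->
    is_formula (form_map (tm_subst sg \o tm_fsubst v t) F).
  by move=> H; rewrite -E; apply: scoped_map => // X u; apply: tm_scoped_subst.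
have HR : val F (tm_subst sg \o tm_fsubst v r) (merge p q') := val_eq (E r) Hr.
have HS := val_rep HE (fun u => rep_fsubst v u Hr' Hs') (W r Fr) (W s Fs) HR.
have HP := val_coval (val_eq (esym (E s)) HS) Hs.
apply: (provable_mono _ _ HP); last exact: ok_merge HL.1 HT.1.
by split=> x; rewrite /= !In_cat; [have := S1 x|have := S2 x]; tauto.
Qed.

(** By closedness of values, the first premise puts its context in the value of
    the cut formula and the second puts its context in the covalue. *)
Lemma cut_sound ps c : cut_rule ps c -> ok c ->
  (forall p, List.In p ps -> ok p /\ forall sg, valid sg p) ->
  forall sg, valid sg c.
Proof.
case=> {ps c} G D L T F Hok HV sg.
have [O1 V1] := HV _ (or_introl erefl).
have [O2 V2] := HV _ (or_intror (or_introl erefl)).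
move=> p q /vals_cat[HG HL] /covals_cat[HD HT].
have [q' [Hq' [S1 S2] Hcq']] := covals_elt O1 HD.
have HP := val_coval (valid_val (V1 sg) HG Hq' Hcq') (valid_coval (V2 sg) HL HT).
apply: (provable_mono _ _ HP); last exact: ok_merge HG.1 HD.1.
by split=> x; rewrite /= !In_cat; [have := S1 x|have := S2 x]; tauto.
Qed.

Lemma soundness S : derivable ok (@LK1eq_rule Sg) S -> forall sg, valid sg S.
Proof.
elim=> ps c Hok HR Hd IH.
have H p : List.In p ps -> ok p /\ forall sg, valid sg p.
  by move=> Hp; split; [case: (Hd p Hp)|exact: IH].
case: HR => [[]|] R; [exact: gentzen_sound R Hok H|exact: eq1_sound R Hok H|].
exact: cut_sound R Hok H.
Qed.

(** Soundness under the identity substitution, read at the element G ⟹ and the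
    test ⟹ D, which lie in the required values by [val_self]. *)
Theorem cut_elimination S : derivable ok (@LK1eq_rule Sg) S -> provable S.
Proof.
move=> HS; have Hok : ok S by case: HS.
have := soundness HS (sg := Free); case: S Hok {HS} => G D Hok HV.
move: (Hok); rewrite ok_split => /and3P[HG HD Hsize].
have E A : form_map (tm_subst Free) A = A := form_map_id A tm_subst_free.
have : provable (merge (G ⟹ [::]) ([::] ⟹ D)).
  apply: HV; split.
  - by rewrite /elt /LK_sequent /= HG orbT.
  - move=> A HA; have [|H _] := @val_self A (tm_subst Free).
      by rewrite E; apply: all_In HG HA.
    rewrite E in H; apply: val_sub H.
      by rewrite /elt /LK_sequent /= HG orbT.
    by split=> x //= [<-|[]].
  - by rewrite ok_split /= HD.
  - move=> A HA; have [|_ H] := @val_self A (tm_subst Free).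
      by rewrite E; apply: all_In HD HA.
    rewrite E in H; apply: coval_sub H; first by rewrite ok_split /= HD.
    by split=> x //= [<-|[]].
by rewrite /merge /= cats0.
Qed.

End CutElimination.

Theorem theorem1p4 (Sg : signature) :
  (forall S : sequent Sg, LJ1eq S -> LJ1eq_cutfree S) /\
  (forall S : sequent Sg, LK1eq S -> LK1eq_cutfree S).
Proof.
split=> S; [exact: (@cut_elimination Sg false)|exact: (@cut_elimination Sg true)].
Qed.
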